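(* Let $G=(A,B,E)$ be a bipartite graph with at least $4$ vertices. The following are equivalent: (i) $G$ is bistable; (ii) $G$ is $\alpha^+$-stable and, for every $a\in A$ and $b\in B$, the graph $G-a-b$ is $\alpha^+$-stable; (iii) for every $a\in A$ and $b\in B$, the graph $G-a-b$ has a perfect matching; (iv) $G$ is connected and every edge of $G$ is contained in some perfect matching of $G$; (v) $|N(X)|>|X|$ for every nonempty proper subset $X$ of $A$ and for every nonempty proper subset $X$ of $B$.
   Context: All graphs are finite and simple. $N(X)$ is the set of vertices adjacent to some vertex of $X$; $G-a-b$ is the graph obtained by deleting vertices $a,b$. For a graph $G$, $\alpha(G)$ is the largest size of a stable set (set of pairwise nonadjacent vertices); a maximum stable set is a stable set of size $\alpha(G)$. $G$ is $\alpha^+$-stable if $\alpha(G+e)=\alpha(G)$ for every pair $e=xy$ of distinct nonadjacent vertices. A bipartite graph $G=(A,B,E)$ (bipartition $\{A,B\}$) is bistable if $A$ and $B$ are exactly the two maximum stable sets of $G$. A perfect matching is a set of pairwise non-incident edges covering all vertices.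
   Formalization: Both sides A and B of the bipartition are assumed nonempty; with A empty and B consisting of 4 isolated vertices, (iii) holds vacuously while (i) fails. *)

(* Defs.v *)
From HB Require Import structures.
From mathcomp Require Import all_boot.

Set Implicit Arguments.
Unset Strict Implicit.
Unset Printing Implicit Defensive.

Record sgraph := SGraph {
  vertex :> finType;
  adj : rel vertex;
  adj_sym : symmetric adj;
  adj_irrefl : irreflexive adj }.

Section Basic.
Variable G : sgraph.

Definition edges : {set {set G}} :=
  [set [set p.1; p.2] | p in [set p : G * G | adj p.1 p.2]].

Definition neighbours (X : {set G}) : {set G} :=
  [set y | [exists x in X, adj x y]].

Definition stable (S : {set G}) : bool :=
  [forall x in S, forall y in S, ~~ adj x y].

Definition alpha : nat := \max_(S : {set G} | stable S) #|S|.

Definition max_stable (S : {set G}) : bool := stable S && (#|S| == alpha).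

Definition perfect_matching (M : {set {set G}}) : bool :=
  [&& M \subset edges, trivIset M & cover M == [set: G]].

Definition has_perfect_matching : Prop := exists M, perfect_matching M.

Definition connected : Prop := forall x y : G, connect (@adj G) x y.

(* Both parts are nonempty, as for any partition: with A empty, conditions on all
   a in A and b in B would hold vacuously, even for edgeless graphs. *)
Definition bipartition (A B : {set G}) : Prop :=
  [/\ A != set0, B != set0, [disjoint A & B], A :|: B = [set: G]
    & stable A && stable B].

Definition bistable (A B : {set G}) : Prop :=
  A <> B /\ forall S : {set G}, max_stable S <-> S = A \/ S = B.

End Basic.

Section Induced.
Variables (G : sgraph) (S : {set G}).

Definition induced_adj : rel {x : G | x \in S} :=
  fun u v => adj (val u) (val v).

Lemma induced_sym : symmetric induced_adj.
Proof. by move=> u v; apply: adj_sym. Qed.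

Lemma induced_irrefl : irreflexive induced_adj.
Proof. by move=> u; apply: adj_irrefl. Qed.

Definition induced : sgraph := SGraph induced_sym induced_irrefl.

End Induced.

Definition delete2 (G : sgraph) (a b : G) : sgraph := induced (~: [set a; b]).

Section AddEdge.
Variables (G : sgraph) (x y : G).

(* When x = y this adds nothing, so that the result is always simple. *)
Definition add_edge_adj : rel G := fun u v =>
  adj u v || [&& u != v & [set u; v] == [set x; y]].

Lemma add_edge_sym : symmetric add_edge_adj.
Proof. by move=> u v; rewrite /add_edge_adj adj_sym eq_sym setUC. Qed.

Lemma add_edge_irrefl : irreflexive add_edge_adj.
Proof. by move=> u; rewrite /add_edge_adj adj_irrefl eqxx. Qed.

Definition add_edge : sgraph := SGraph add_edge_sym add_edge_irrefl.

End AddEdge.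

Definition alpha_plus_stable (G : sgraph) : Prop :=
  forall x y : G, x != y -> ~~ adj x y -> alpha (add_edge x y) = alpha G.

(* Main.v *)
Require Import Defs.
From HB Require Import structures.
From mathcomp Require Import all_boot zify.

(** Condition (v) is the hub. It turns every stable set that meets both sides
    into one that is smaller than a side, giving (i); by Hall's theorem it gives
    a perfect matching of G - a - b, hence (iii) and (iv). Conversely a perfect
    matching of G - a - b, with a outside X and b in N(X), injects X into
    N(X) - b; and under (iv) connectedness yields an edge between A - X and N(X),
    and a perfect matching containing it injects X into N(X) minus one vertex.
    If |N(X)| <= |X| with X in A, then X together with B - N(X) is a third
    maximum stable set, so (i) gives (v).

    For (ii) => (i): in an alpha+-stable graph at most one vertex lies in all
    maximum stable sets. Maximum stable sets of a bipartite graph are closed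
    under crossover (union on one side, intersection on the other), so the
    extremal ones show that either both sides are maximum stable sets, or one
    side has exactly one vertex more and contains an isolated vertex. In the
    second case some G - a - b would have two isolated vertices. *)

Set Implicit Arguments.
Unset Strict Implicit.
Unset Printing Implicit Defensive.

(** * Hall's theorem *)

Section Hall.
Variables (T U : finType) (u0 : U).
Implicit Types (A X : {set T}) (E : T -> {set U}).

Lemma hall_bigcupD E X (D : {set U}) :
  \bigcup_(x in X) (E x :\: D) = (\bigcup_(x in X) E x) :\: D.
Proof.
apply/setP => u; rewrite inE; apply/bigcupP/idP.
  by case=> x xX /setDP[uE uD]; rewrite uD; apply/bigcupP; exists x.
by case/andP=> uD /bigcupP[x xX uE]; exists x; rewrite // inE uD.
Qed.

(* Halmos-Vaughan: split along a tight set if there is one; otherwise match one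
   element arbitrarily. *)
Theorem hall A E :
  (forall X, X \subset A -> #|X| <= #|\bigcup_(x in X) E x|) ->
  exists f : T -> U, {in A &, injective f} /\ {in A, forall x, f x \in E x}.
Proof.
have [n] := ubnP #|A|; elim: n => // n IHn in A E *; rewrite ltnS => leAn hE.
have [->|[a aA]] := set_0Vmem A.
  by exists (fun=> u0); split=> [x y|x]; rewrite inE.
have [/existsP[X /and3P[XA X0 /eqP tightX]]|notight] :=
  boolP [exists X : {set T},
           [&& X \proper A, X != set0 & #|\bigcup_(x in X) E x| == #|X|]].
  set D := \bigcup_(x in X) E x in tightX.
  have sXA := proper_sub XA.
  have [|Y sYX|f [fI fE]] := IHn X E.
  - exact: leq_trans (proper_card XA) leAn.
  - exact/hE/(subset_trans sYX).
  have [||g [gI gE]] := IHn (A :\: X) (fun x => E x :\: D).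
  - have := cardsID X A; rewrite (setIidPr sXA); move: X0; rewrite -card_gt0; lia.
  - move=> Y sY; rewrite hall_bigcupD.
    have dXY : [disjoint X & Y].
      by rewrite disjoint_sym; apply: disjointWl sY _; rewrite -setI_eq0 setDE
         -setIA [~: X :&: X]setIC setICr setI0.
    (* Hall's condition for [X :|: Y], minus the tight equality [#|D| = #|X|], is the condition for
       [Y] with [D] removed. *)
    have := hE (X :|: Y); rewrite bigcup_setU -/D.
    have -> : X :|: Y \subset A.
      by rewrite subUset sXA (subset_trans sY) ?subsetDl.
    move=> /(_ isT); have := cardsUI X Y.
    rewrite (disjoint_setI0 dXY) cards0.
    set Z := \bigcup_(x in Y) E x.
    have -> : D :|: Z = D :|: (Z :\: D).
      by apply/setP => u; rewrite !inE; case: (u \in D).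
    have := leq_card_setU D (Z :\: D); case=> [+ _]; lia.
  exists (fun x => if x \in X then f x else g x); split; last first.
    move=> x xA; case: ifP => [|/negbT] xX; first exact: fE.
    have /gE/setDP[] : x \in A :\: X by rewrite inE xX.
    by [].
  have fD x : x \in X -> f x \in D by move=> xX; apply/bigcupP; exists x; rewrite ?fE.
  have gD x : x \in A -> x \notin X -> g x \notin D.
    move=> xA xX; have /gE/setDP[] : x \in A :\: X by rewrite inE xX.
    by [].
  move=> x y xA yA /=; case: ifP => xX; case: ifP => yX.
  - exact: fI.
  - by move=> fg; move: (gD y yA); rewrite yX -fg fD // => /(_ isT).
  - by move=> fg; move: (gD x xA); rewrite xX fg fD // => /(_ isT).
  - by apply: gI; rewrite inE ?xX ?yX.
have [u uE] : exists u, u \in E a.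
  apply/set0Pn; rewrite -card_gt0; have := hE [set a].
  by rewrite sub1set aA cards1 big_set1; apply.
have [||f [fI fE]] := IHn (A :\ a) (fun x => E x :\: [set u]).
- by move: leAn; rewrite (cardsD1 a A) aA.
- move=> Y sY; rewrite hall_bigcupD.
  (* With no tight set the inequality is strict on nonempty [Y], which pays for the possible loss of
     [u]. *)
  have [->|Y0] := eqVneq Y set0; first by rewrite cards0.
  have sYA : Y \proper A by apply: sub_proper_trans sY _; rewrite properD1.
  have := hE Y (proper_sub sYA).
  move/existsPn/(_ Y): notight; rewrite sYA Y0 /=.
  rewrite [X in X != _](cardsD1 u) [X in _ <= X](cardsD1 u); lia.
exists (fun x => if x == a then u else f x); split; last first.
  move=> x xA; case: eqP => [->//|/eqP xa].
  have /fE/setDP[] : x \in A :\ a by rewrite !inE xa.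
  by [].
have fu x : x \in A -> x != a -> f x != u.
  move=> xA xa; have /fE/setDP[_] : x \in A :\ a by rewrite !inE xa.
  by rewrite inE.
move=> x y xA yA /=; case: (eqVneq x a) => [->|xa]; case: (eqVneq y a) => [->|ya] //.
- by move=> e; move: (fu y yA ya); rewrite -e eqxx.
- by move=> e; move: (fu x xA xa); rewrite e eqxx.
- by apply: fI; rewrite !inE ?xa ?ya.
Qed.

End Hall.

(** * Stable sets and perfect matchings *)

Section Graph.
Variable G : sgraph.
Implicit Types (A B S T X Y : {set G}) (M : {set {set G}}).

Lemma stableP S : reflect {in S &, forall x y, ~~ adj x y} (stable S).
Proof.
apply: (iffP forall_inP) => [h x y xS yS|h x xS].
  by have /forall_inP := h x xS; apply.
by apply/forall_inP => y; apply: h.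
Qed.

Lemma stable_card S : stable S -> #|S| <= alpha G.
Proof. by move=> sS; apply: (@leq_bigmax_cond _ _ (fun S : {set G} => #|S|)). Qed.

Lemma max_stable_exists : exists S : {set G}, max_stable S.
Proof.
have s0 : stable (set0 : {set G}) by apply/stableP => x y; rewrite inE.
have [|S sS eS] := @eq_bigmax_cond _ (fun S : {set G} => stable S) (fun S => #|S|).
  by apply/card_gt0P; exists set0.
by exists S; rewrite /max_stable; apply/andP; split; [|apply/eqP/esym].
Qed.

Lemma alphaP k S : stable S -> #|S| = k ->
  (forall T, stable T -> #|T| <= k) -> alpha G = k.
Proof.
move=> sS cS hk; apply/eqP; rewrite eqn_leq -{2}cS stable_card // andbT.
exact/bigmax_leqP.
Qed.

Lemma mem_neighbours x y X : x \in X -> adj x y -> y \in neighbours X.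
Proof. by move=> xX xy; rewrite inE; apply/existsP; exists x; rewrite xX. Qed.

Lemma neighboursP y X :
  reflect (exists2 x, x \in X & adj x y) (y \in neighbours X).
Proof.
by rewrite inE; apply: (iffP existsP) => [[x /andP[]]|[x]]; exists x => //; apply/andP.
Qed.

Lemma edge_mem x y : adj x y -> [set x; y] \in edges G.
Proof. by move=> xy; apply/imsetP; exists (x, y); rewrite ?inE. Qed.

(** Blocks sharing a vertex coincide, so partners are unique. The involution turns counting along a
    matching into injectivity. *)
Lemma perfect_matching_partner M : perfect_matching M ->
  exists g : G -> G, [/\ forall x, adj x (g x), involutive g
                       & forall x y, [set x; y] \in M -> g x = y].
Proof.
case/and3P=> /subsetP sM /trivIsetP tM /eqP cM.
have blockE e x : e \in M -> x \in e -> exists2 y, e = [set x; y] & adj x y.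
  move=> /sM /imsetP[[u v]]; rewrite inE /= => uv -> /set2P[]->.
    by exists v.
  by exists u; [apply: setUC|rewrite adj_sym].
have same e f x : e \in M -> f \in M -> x \in e -> x \in f -> e = f.
  move=> eM fM xe xf; apply/eqP/negPn/negP => /(tM _ _ eM fM) /pred0P/(_ x) /=.
  by rewrite xe xf.
have uniqP x y z : [set x; y] \in M -> [set x; z] \in M -> y = z.
  move=> yM zM; have e := same _ _ x yM zM (set21 _ _) (set21 _ _).
  have : y \in [set x; z] by rewrite -e set22.
  have : z \in [set x; y] by rewrite e set22.
  move=> /set2P[zx|->//] /set2P[yx|//].
  by rewrite zx yx.
have ex x : exists y, [set x; y] \in M.
  have : x \in cover M by rewrite cM.
  by case/bigcupP=> e eM /(blockE _ _ eM)[y ey _]; exists y; rewrite -ey.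
pose g x := xchoose (ex x); have gM x : [set x; g x] \in M by exact: (xchooseP (ex x)).
exists g; split=> [x|x|x y xy]; last exact: uniqP _ _ _ (gM x) xy.
- have [y gy xy] := blockE _ x (gM x) (set21 _ _).
  by rewrite (uniqP x (g x) y) // -gy.
- by apply: uniqP _ _ _ (gM (g x)) _; rewrite setUC.
Qed.

Lemma partner_perfect_matching (g : G -> G) :
  (forall x, adj x (g x)) -> involutive g ->
  perfect_matching [set [set x; g x] | x : G].
Proof.
move=> adjg gK; apply/and3P; split.
- by apply/subsetP => _ /imsetP[x _ ->]; apply: edge_mem.
- apply/trivIsetP => _ _ /imsetP[x _ ->] /imsetP[y _ ->].
  apply: contraR => /pred0Pn[z /andP[/= /set2P zx /set2P zy]]; apply/eqP.
  by case: zx zy => -> [] => [->|xg|gx|/(inv_inj gK)->] //;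
     rewrite ?xg -?gx gK setUC.
- apply/eqP/setP => x; rewrite inE; apply/bigcupP.
  by exists [set x; g x]; [apply/imsetP; exists x | rewrite set21].
Qed.

Lemma card_neighbours_partner (g : G -> G) X :
  (forall x, adj x (g x)) -> involutive g -> #|X| <= #|neighbours X|.
Proof.
move=> adjg gK; rewrite -(card_imset _ (inv_inj gK)).
apply/subset_leq_card/subsetP => _ /imsetP[x xX ->].
exact: mem_neighbours xX (adjg x).
Qed.

End Graph.

(** * Adding an edge: alpha+-stable graphs *)

Section AlphaPlus.
Variable G : sgraph.
Implicit Types S T : {set G}.

(** Sharing a stable set, [x] and [y] are nonadjacent. If they were distinct, joining them would
    keep [alpha], leaving a maximum stable set of [G] without one of them. *)
Lemma alpha_plus_stable_core x y : alpha_plus_stable G ->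
  (forall S, max_stable S -> x \in S /\ y \in S) -> x = y.
Proof.
move=> aG core; apply/eqP/negPn/negP => xy.
have [S0 mS0] := max_stable_exists G; have /andP[/stableP sS0 _] := mS0.
have [x0 y0] := core _ mS0.
have [S /andP[/stableP sS /eqP cS]] := max_stable_exists (add_edge x y).
have mS : max_stable (S : {set G}).
  rewrite /max_stable cS (aG x y) ?sS0 // eqxx andbT; apply/stableP => u v uS vS.
  by have := sS u v uS vS; rewrite negb_or => /andP[].
have [xS yS] := core _ mS.
by have := sS x y xS yS; rewrite /= /add_edge_adj xy eqxx orbT.
Qed.

(** A new edge has both ends in at most one of two disjoint sets, so the other one stays stable. *)
Lemma disjoint_max_stable S T : max_stable S -> max_stable T -> [disjoint S & T] ->
  alpha_plus_stable G.
Proof.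
move=> /andP[sS /eqP cS] /andP[sT /eqP cT] dST x y xy _.
have sub (U : {set G}) : stable U -> ~~ ((x \in U) && (y \in U)) ->
  stable (U : {set add_edge x y}).
  move=> /stableP sU xyU; apply/stableP => u v uU vU /=.
  rewrite negb_or sU //=; apply/negP => /andP[_ /eqP e].
  case/negP: xyU; have : x \in [set u; v] by rewrite e set21.
  have : y \in [set u; v] by rewrite e set22.
  by case/set2P=> -> /set2P[]->; rewrite ?uU ?vU.
have [U [sU cU xyU]] : exists U : {set G},
  [/\ stable U, #|U| = alpha G & ~~ ((x \in U) && (y \in U))].
  have [/andP[xS yS]|?] := boolP ((x \in S) && (y \in S)); last by exists S.
  by exists T; split=> //; rewrite (disjointFr dST xS).
apply: (@alphaP (add_edge x y) _ U) => // [|W /stableP sW]; first exact: sub.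
apply: stable_card; apply/stableP => u v uW vW.
by have := sW u v uW vW; rewrite negb_or => /andP[].
Qed.

End AlphaPlus.

(** * Induced subgraphs and vertex deletion *)

Section InducedTheory.
Variables (G : sgraph) (S : {set G}).
Local Notation H := (induced S).
Implicit Types (X Y : {set G}) (T : {set H}).

Definition trace X : {set H} := [set u : H | val u \in X].

Definition extend T : {set G} := [set val u | u in T].

Lemma mem_extend T u : (val u \in extend T) = (u \in T).
Proof. exact: (mem_imset _ _ val_inj). Qed.

Lemma extend_sub T : extend T \subset S.
Proof. by apply/subsetP => _ /imsetP[u _ ->]; apply: valP. Qed.

Lemma card_extend T : #|extend T| = #|T|.
Proof. exact: card_imset val_inj. Qed.

Lemma extend_trace X : extend (trace X) = X :&: S.
Proof.
apply/setP => x; rewrite inE; apply/imsetP/andP => [[u]|[xX xS]].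
  by rewrite inE => uX ->; split=> //; apply: valP.
by exists (Sub x xS : H); rewrite ?inE ?SubK.
Qed.

Lemma card_trace X : #|trace X| = #|X :&: S|.
Proof. by rewrite -card_extend extend_trace. Qed.

Lemma stable_extend T : stable (extend T) = stable T.
Proof.
apply/stableP/stableP => sT => [u v uT vT|].
  by apply: (sT (val u) (val v)); rewrite mem_extend.
by move=> _ _ /imsetP[u uT ->] /imsetP[v vT ->]; apply: sT.
Qed.

Lemma stable_trace X : stable X -> stable (trace X).
Proof.
by move=> /stableP sX; apply/stableP => u v; rewrite !inE => uX vX; apply: sX.
Qed.

Lemma alpha_induced_ge X : X \subset S -> stable X -> #|X| <= alpha H.
Proof.
move=> XS sX; rewrite -(setIidPl XS) -card_trace; exact/stable_card/stable_trace.
Qed.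

Lemma card_neighbours_induced X : has_perfect_matching H -> X \subset S ->
  #|X| <= #|neighbours X :&: S|.
Proof.
move=> [M /perfect_matching_partner[g [adjg gK _]]] XS.
rewrite -{1}(setIidPl XS) -card_trace.
apply: leq_trans (card_neighbours_partner (trace X) adjg gK) _.
rewrite -card_extend; apply/subset_leq_card/subsetP.
move=> x /imsetP[v /neighboursP[u]]; rewrite inE => uX uv ->; rewrite in_setI (valP v) andbT.
exact: mem_neighbours uX uv.
Qed.

End InducedTheory.

Lemma perfect_matching_delete2 (G : sgraph) (a b : G) :
  adj a b -> has_perfect_matching (delete2 a b) ->
  exists M : {set {set G}}, perfect_matching M /\ [set a; b] \in M.
Proof.
move=> ab [M /perfect_matching_partner[g [adjg gK _]]].
have nab : a != b by apply/eqP => e; rewrite e adj_irrefl in ab.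
(* The partner map of the rest is extended by swapping [a] and [b], the two vertices on which
   [insub] fails. *)
pose h x := if insub x is Some u then val (g u) else if x == a then b else a.
have hval u : h (val u) = val (g u) by rewrite /h valK.
have ha : h a = b by rewrite /h insubN ?inE ?eqxx.
have hb : h b = a by rewrite /h insubN ?inE ?eqxx ?orbT // eq_sym (negbTE nab).
have split_vertex x : [\/ x = a, x = b | exists u : delete2 a b, x = val u].
  have [xa|xa] := eqVneq x a; first by constructor 1.
  have [xb|xb] := eqVneq x b; first by constructor 2.
  have xS : x \in ~: [set a; b] by rewrite !inE negb_or xa.
  by constructor 3; exists (Sub x xS).
exists [set [set x; h x] | x : G]; split.
  apply: partner_perfect_matching => x; case: (split_vertex x) => [->|->|[u ->]].
  - by rewrite ha.
  - by rewrite hb adj_sym.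
  - by rewrite hval; apply: adjg.
  - by rewrite ha hb.
  - by rewrite hb ha.
  - by rewrite !hval gK.
by apply/imsetP; exists a; rewrite ?ha.
Qed.

(** * Bipartite graphs *)

(** Unlike in [bipartition], sides may be empty, so the notion passes to every induced subgraph. *)
Definition bisplit (G : sgraph) (A B : {set G}) : Prop :=
  [/\ B = ~: A, stable A & stable B].

Definition expanding (G : sgraph) (A : {set G}) : Prop :=
  forall X : {set G}, X != set0 -> X \proper A -> #|X| < #|neighbours X|.

Definition isolated (G : sgraph) (v : G) : Prop := forall x, ~~ adj v x.

Lemma bisplitC (G : sgraph) (A B : {set G}) : bisplit A B -> bisplit B A.
Proof. by case=> -> sA sB; split; rewrite ?setCK. Qed.

Lemma bipartition_bisplit (G : sgraph) (A B : {set G}) :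
  bipartition A B -> bisplit A B.
Proof.
case=> _ _ dAB AB /andP[sA sB]; split=> //; apply/setP => x; rewrite inE.
have : x \in A :|: B by rewrite AB.
by rewrite inE; case: (boolP (x \in A)) => //= /(disjointFr dAB).
Qed.

Lemma bisplit_trace (G : sgraph) (S A B : {set G}) :
  bisplit A B -> bisplit (trace S A) (trace S B).
Proof.
by case=> -> sA sB; split; try exact: stable_trace; apply/setP => u; rewrite !inE.
Qed.

Lemma isolated_max_stable (G : sgraph) (v : G) (S : {set G}) :
  isolated v -> max_stable S -> v \in S.
Proof.
move=> iv /andP[/stableP sS /eqP cS]; apply/negPn/negP => vS.
have : stable (v |: S).
  apply/stableP => x y /setU1P[->|xS] /setU1P[->|yS] //; last exact: sS.
  by rewrite adj_sym.
by move/stable_card; rewrite cardsU1 vS -cS ltnn.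
Qed.

Lemma isolated_unique (G : sgraph) (v w : G) :
  alpha_plus_stable G -> isolated v -> isolated w -> v = w.
Proof.
by move=> aG iv iw; apply: alpha_plus_stable_core => // S mS;
   split; apply: isolated_max_stable.
Qed.

Lemma delete2C (G : sgraph) (a b : G) : delete2 a b = delete2 b a.
Proof. by rewrite /delete2 setUC. Qed.

Section Bisplit.
Variables (G : sgraph) (A B : {set G}).
Hypothesis sAB : bisplit A B.
Implicit Types (S T X : {set G}).

Lemma bisplit_memB x : (x \in B) = (x \notin A).
Proof. by case: sAB => -> _ _; rewrite inE. Qed.

Lemma bisplit_card S : #|S| = #|S :&: A| + #|S :&: B|.
Proof. by case: sAB => -> _ _; rewrite -setDE cardsID. Qed.

Lemma bisplit_cardT : #|G| = #|A| + #|B|.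
Proof. by rewrite -cardsT bisplit_card !setTI. Qed.

Lemma bisplit_adj x y : adj x y -> (y \in A) = (x \in B).
Proof.
case: sAB => eB /stableP sA /stableP sB xy; rewrite bisplit_memB.
apply/idP/idP => [yA|xA]; first by apply: contraL xy => xA; apply: sA.
by apply: contraLR xy => yA; apply: sB; rewrite bisplit_memB.
Qed.

Lemma neighbours_subB X : X \subset A -> neighbours X \subset B.
Proof.
move=> /subsetP XA; apply/subsetP => y /neighboursP[x /XA xA xy].
by rewrite bisplit_memB (bisplit_adj xy) bisplit_memB xA.
Qed.

Definition crossover S T : {set G} := (S :|: T) :&: A :|: S :&: T :&: B.

Lemma crossoverA S T : crossover S T :&: A = (S :|: T) :&: A.
Proof.
apply/setP => x; rewrite !inE bisplit_memB.
by case: (x \in A); rewrite ?andbF ?andbT ?orbF.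
Qed.

Lemma crossoverB S T : crossover S T :&: B = S :&: T :&: B.
Proof.
apply/setP => x; rewrite !inE bisplit_memB.
by case: (x \in A); rewrite ?andbF ?andbT ?orbF.
Qed.

(** An edge inside would join a vertex of [S] or [T] on side [A] to a vertex of both on side [B],
    hence lie within [S] or within [T]. *)
Lemma stable_crossover S T : stable S -> stable T -> stable (crossover S T).
Proof.
move=> /stableP sS /stableP sT; apply/stableP => x y.
wlog xA : x y / x \in A.
  move=> wl xC yC; apply/negP => xy.
  have [xA|xA] := boolP (x \in A); first by move/negP: (wl x y xA xC yC).
  have yA : y \in A by rewrite (bisplit_adj xy) bisplit_memB.
  by move/negP: (wl y x yA yC xC); rewrite adj_sym.
move=> xC yC; apply/negP => xy.
have yB : y \in B by rewrite bisplit_memB (bisplit_adj xy) bisplit_memB xA.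
have : x \in crossover S T :&: A by rewrite inE xC.
have : y \in crossover S T :&: B by rewrite inE yC.
rewrite crossoverA crossoverB !inE => /andP[/andP[yS yT] _] /andP[/orP[xS|xT] _].
  by move/negP: (sS x y xS yS).
by move/negP: (sT x y xT yT).
Qed.

End Bisplit.

(** Equal sizes make Hall's injection a bijection from [A] onto [B]; together with its inverse it is
    the partner map. *)
Lemma hall_perfect_matching (G : sgraph) (A B : {set G}) :
  bisplit A B -> #|A| = #|B| ->
  (forall X : {set G}, X \subset A -> #|X| <= #|neighbours X|) ->
  has_perfect_matching G.
Proof.
move=> sAB cAB hA.
(* [hall] needs a default vertex [a0]; without one the graph is empty and so is the matching. *)
have [A0|[a0 _]] := set_0Vmem A.
  have T0 : #|[set: G]| = 0.
    by rewrite cardsT (bisplit_cardT sAB) -cAB A0 cards0.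
  have noG (x : G) : False by have := in_setT x; rewrite (cards0_eq T0) inE.
  exists set0; apply/and3P; split; first exact: sub0set.
    by apply/trivIsetP => e f; rewrite inE.
  by apply/eqP/setP => x; case: (noG x).
have [X XA|f [fI fN]] := @hall G G a0 A (fun x => neighbours [set x]).
  apply: leq_trans (hA X XA) (subset_leq_card _); apply/subsetP => y.
  case/neighboursP=> x xX xy; apply/bigcupP; exists x => //.
  by apply: mem_neighbours xy; rewrite set11.
have fadj x : x \in A -> adj x (f x).
  by move=> /fN /neighboursP[_ /set1P->].
have fB : f @: A = B.
  apply/eqP; rewrite eqEcard card_in_imset // cAB leqnn andbT.
  apply/subsetP => _ /imsetP[x xA ->].
  by rewrite (bisplit_memB sAB) (bisplit_adj sAB (fadj x xA)) (bisplit_memB sAB) xA.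
have fnA x : x \in A -> f x \notin A.
  by move=> xA; rewrite -(bisplit_memB sAB) -fB imset_f.
pose g y := if y \in A then f y else odflt y [pick x in A | f x == y].
have gA x : x \in A -> g x = f x by rewrite /g => ->.
have gf x : x \in A -> g (f x) = x.
  move=> xA; rewrite /g (negbTE (fnA x xA)).
  case: pickP => [z /andP[zA /eqP /fI]|/(_ x)]; first exact.
  by rewrite xA eqxx.
have vertexE y : y \in A \/ exists2 x, x \in A & y = f x.
  have [|yA] := boolP (y \in A); [by left | right].
  by have : y \in f @: A; [rewrite fB (bisplit_memB sAB) | case/imsetP=> x; exists x].
exists [set [set x; g x] | x : G]; apply: partner_perfect_matching => y.
  case: (vertexE y) => [yA|[x xA ->]]; first by rewrite gA // fadj.
  by rewrite gf // adj_sym fadj.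
by case: (vertexE y) => [yA|[x xA ->]]; [rewrite (gA y) // gf | rewrite gf // gA].
Qed.

(** * Alpha+-stable bipartite graphs *)

Section AlphaPlusBisplit.
Variable G : sgraph.
Implicit Types A B S T X : {set G}.

(** On each side one crossover carries the union and the other the intersection. Hence for maximum
    [S] and [T] neither crossover can fall below [alpha]. *)
Lemma card_crossover A B S T : bisplit A B ->
  #|crossover A B S T| + #|crossover B A S T| = #|S| + #|T|.
Proof.
move=> sAB; have sBA := bisplitC sAB.
rewrite (bisplit_card sAB (crossover A B S T)) crossoverA // crossoverB //.
rewrite (bisplit_card sBA (crossover B A S T)) crossoverA // crossoverB //.
rewrite (bisplit_card sAB S) (bisplit_card sAB T).
have := cardsUI (S :&: A) (T :&: A); have := cardsUI (S :&: B) (T :&: B).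
rewrite -!setIUl -!setIIl; lia.
Qed.

(* A maximum stable set with the largest trace on A has the smallest trace on B,
   because maximum stable sets are closed under crossover. *)
Lemma max_stable_extremal A B : bisplit A B ->
  exists2 S, max_stable S & forall T, max_stable T -> S :&: B \subset T.
Proof.
move=> sAB; have [S0 mS0] := max_stable_exists G.
case: (arg_maxnP (fun S : {set G} => #|S :&: A|) mS0) => S mS Smax.
exists S => // T mT.
have [/andP[sS /eqP cS] /andP[sT /eqP cT]] := (mS, mT).
have cW := card_crossover S T sAB.
have sW := stable_crossover sAB sS sT.
have lW := stable_card sW.
have lW' := stable_card (stable_crossover (bisplitC sAB) sS sT).
have mW : max_stable (crossover A B S T) by rewrite /max_stable sW /=; lia.
have := Smax _ mW; rewrite /= => lSA.
have : #|S :&: B| <= #|S :&: T :&: B|.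
  have := bisplit_card sAB (crossover A B S T); have := bisplit_card sAB S.
  rewrite (crossoverB sAB); lia.
have sub : S :&: T :&: B \subset S :&: B by rewrite setSI ?subsetIl.
move=> le; have /eqP <- : S :&: T :&: B == S :&: B by rewrite eqEcard sub.
by apply/subsetP => x; rewrite !inE => /andP[/andP[]].
Qed.

Definition excess_vertex A B : Prop :=
  exists v, [/\ v \in B, #|B| = alpha G, #|B| = #|A|.+1 & isolated v].

(** The extremal sets [S] and [R] have all of [S :&: B] and [R :&: A] in every maximum stable set,
    and alpha+-stability leaves room for only one such vertex. *)
Lemma alpha_plus_stable_side A B : bisplit A B -> alpha_plus_stable G ->
  #|A| = alpha G \/ excess_vertex A B.
Proof.
move=> sAB aG; have [_ sA sB] := sAB.
have [S mS coreS] := max_stable_extremal sAB.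
have [R mR coreR] := max_stable_extremal (bisplitC sAB).
have [/andP[/stableP sS /eqP cS] /andP[_ /eqP cR]] := (mS, mR).
have [SB0|[v vSB]] := set_0Vmem (S :&: B).
  left; apply/eqP; rewrite eqn_leq stable_card // -cS (bisplit_card sAB S).
  by rewrite SB0 cards0 addn0 subset_leq_card ?subsetIr.
have core x : x \in S :&: B \/ x \in R :&: A -> x = v.
  move=> xSR; apply: alpha_plus_stable_core => // T mT.
  split; last exact: (subsetP (coreS T mT)).
  by case: xSR; [exact: (subsetP (coreS T mT)) | exact: (subsetP (coreR T mT))].
have [vS vB] := setIP vSB.
have vA : v \notin A by rewrite -(bisplit_memB sAB).
have cB : #|B| = alpha G.
  apply/eqP; rewrite eqn_leq stable_card //= -cR (bisplit_card sAB R).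
  (* Its only possible member is [v], which lies in [B]; so [R] lies inside [B]. *)
  have -> : R :&: A = set0.
    apply/setP => x; rewrite [RHS]inE; apply/negP => xRA.
    have xv : x = v by apply: core; right.
    by move: xRA; rewrite xv inE (negbTE vA) andbF.
  by rewrite cards0 subset_leq_card ?subsetIr.
have SB1 : S :&: B = [set v].
  by apply/eqP; rewrite eqEsubset sub1set vSB andbT; apply/subsetP => x xSB;
     rewrite inE (core x) //; left.
have cSA : #|S :&: A|.+1 = alpha G.
  by rewrite -cS (bisplit_card sAB S) SB1 cards1 addn1.
have leSA : #|S :&: A| <= #|A| by rewrite subset_leq_card ?subsetIr.
(* A maximum [A] would contain [v]. So [#|A|] is at most [alpha G - 1], the size of [S :&: A]; then
   [S] contains [A], and [v] has no neighbour. *)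
have cA : #|A| != alpha G.
  apply/negP => cA; have mA : max_stable A by rewrite /max_stable sA.
  by case/negP: vA; apply: (subsetP (coreS A mA)).
have leA := stable_card sA.
have SA : S :&: A = A by apply/eqP; rewrite eqEcard subsetIr; lia.
right; exists v; split=> // [|x]; first lia.
apply/negP => vx; have xA : x \in A by rewrite (bisplit_adj sAB vx).
have xS : x \in S by move: xA; rewrite -SA inE => /andP[].
by move/negP: (sS v x vS xS).
Qed.

Lemma alpha_plus_stable_bisplit A B : bisplit A B -> alpha_plus_stable G ->
  [\/ #|A| = alpha G /\ #|B| = alpha G, excess_vertex A B | excess_vertex B A].
Proof.
move=> sAB aG.
have [cA|?] := alpha_plus_stable_side sAB aG; last by constructor 2.
have [cB|?] := alpha_plus_stable_side (bisplitC sAB) aG; last by constructor 3.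
by constructor 1.
Qed.

Lemma card_trace_delete2 (a b : G) X : a \in X -> b \notin X ->
  #|trace (~: [set a; b]) X| = #|X|.-1.
Proof.
move=> aX bX; rewrite card_trace (cardsD1 a X) aX; congr #|pred_of_set _|.
apply/setP => x; rewrite !inE; have [->|] := eqVneq x a; first by rewrite andbF.
by have [->|] := eqVneq x b; rewrite ?andbT // andbF (negbTE bX).
Qed.

End AlphaPlusBisplit.

(** * Bistability and alpha+-stability of [G] and [G - a - b] *)

Section Bistable.
Variable G : sgraph.
Hypothesis cardG : 4 <= #|G|.
Implicit Types A B S T X : {set G}.

(* If v is the excess vertex of G, then some v' is an excess vertex of G - a - v;
   both are isolated in G - a - b for any further b. *)
Lemma excess_vertex_delete2 A B : bisplit A B -> excess_vertex A B ->
  (forall a b, a \in A -> b \in B -> alpha_plus_stable (delete2 a b)) -> False.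
Proof.
move=> sAB [v [vB cB cBA iv]] h2; have cG := bisplit_cardT sAB.
have /card_gt0P[a aA] : 0 < #|A| by lia.
have aB : a \notin B by rewrite (bisplit_memB sAB) aA.
have vA : v \notin A by rewrite -(bisplit_memB sAB).
have cA' := card_trace_delete2 aA vA.
have cB' : #|trace (~: [set a; v]) B| = #|B|.-1.
  by rewrite setUC card_trace_delete2.
have [v' v'B iv'] : exists2 v' : delete2 a v, val v' \in B & isolated v'.
  (* One vertex leaves each side, so [B] stays ahead by one: only the excess on the [B] side is
     possible. *)
  case: (alpha_plus_stable_bisplit (bisplit_trace _ sAB) (h2 a v aA vB)).
  - by case; lia.
  - by case=> v' [v'B _ _ iv']; exists v'; move: v'B; rewrite ?inE.
  - by case=> ? [_ _]; lia.
have := valP v'; rewrite !inE negb_or => /andP[v'a v'v].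
(* Four vertices and [#|B| = #|A| + 1] force [#|B| >= 3], which supplies a third vertex [b]. *)
have /card_gt0P[b] : 0 < #|B :\ v :\ val v'|.
  have := cardsD1 v B; have := cardsD1 (val v') (B :\ v).
  by rewrite !inE v'v v'B vB; lia.
rewrite !inE => /and3P[bv' bv bB].
have va : v != a by apply: contraNneq aB => <-.
have vK : v \in ~: [set a; b] by rewrite !inE negb_or va eq_sym.
have v'K : val v' \in ~: [set a; b] by rewrite !inE negb_or v'a eq_sym.
have /(congr1 val) : (Sub v vK : delete2 a b) = Sub (val v') v'K; last first.
  by rewrite !SubK => e; move: v'v; rewrite -e eqxx.
apply: isolated_unique (h2 a b aA bB) _ _ => x; rewrite /= /induced_adj SubK //.
have [->|xv] := eqVneq (val x) v; first by rewrite adj_sym.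
have := valP x; rewrite !inE negb_or => /andP[xa _].
have xH : val x \in ~: [set a; v] by rewrite !inE negb_or xa.
exact: (iv' (Sub (val x) xH)).
Qed.

(** A third maximum stable set misses some [a] and [b], hence survives in [G - a - b]. There the
    sides have equal size [alpha G - 1], which excludes an excess vertex and so must be the
    stability number. *)
Lemma alpha_plus_stable_bistable A B : bisplit A B -> alpha_plus_stable G ->
  (forall a b, a \in A -> b \in B -> alpha_plus_stable (delete2 a b)) ->
  bistable A B.
Proof.
move=> sAB aG h2; have [_ sA sB] := sAB.
case: (alpha_plus_stable_bisplit sAB aG) => [[cA cB]|e|e]; first last.
- case: (excess_vertex_delete2 (bisplitC sAB) e) => b a bB aA.
  by rewrite delete2C; apply: h2.
- by case: (excess_vertex_delete2 sAB e).
have cG := bisplit_cardT sAB.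
have neAB : A <> B.
  move=> e; have /card_gt0P[x xA] : 0 < #|A| by lia.
  by have := bisplit_memB sAB x; rewrite -e xA.
split=> // S; split=> [mS|[]->]; rewrite /max_stable ?sA ?sB ?cA ?cB ?eqxx //.
have /andP[sS /eqP cS] := mS.
have sub_eq T : T \subset S -> #|T| = alpha G -> S = T.
  by move=> TS cT; apply/esym/eqP; rewrite eqEcard TS cT cS leqnn.
have [/sub_eq/(_ cA)|/subsetPn[a aA aS]] := boolP (A \subset S); first by left.
have [/sub_eq/(_ cB)|/subsetPn[b bB bS]] := boolP (B \subset S); first by right.
have SK : S \subset ~: [set a; b].
  apply/subsetP => x xS; rewrite !inE negb_or.
  by apply/andP; split; [apply: contraNneq aS => <-|apply: contraNneq bS => <-].
have := alpha_induced_ge SK sS.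
have bA : b \notin A by rewrite -(bisplit_memB sAB).
have aB : a \notin B by rewrite (bisplit_memB sAB) aA.
have cA' := card_trace_delete2 aA bA.
have cB' : #|trace (~: [set a; b]) B| = #|B|.-1.
  by rewrite setUC card_trace_delete2.
have := alpha_plus_stable_bisplit (bisplit_trace _ sAB) (h2 a b aA bB).
by case; [case|case=> ? [_ _]|case=> ? [_ _]]; rewrite ?cA' ?cB' /delete2; lia.
Qed.

(** A stable set of size [alpha G] in [G - a - b] would be [A] or [B] while missing [a] and [b]. So
    [alpha] drops by one, and the traces of [A] and [B] are disjoint maximum stable sets. *)
Lemma bistable_alpha_plus_stable A B : bisplit A B -> bistable A B ->
  alpha_plus_stable G /\
  (forall a b, a \in A -> b \in B -> alpha_plus_stable (delete2 a b)).
Proof.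
move=> sAB [_ bi]; have [_ sA sB] := sAB.
have mA : max_stable A by apply/bi; left.
have mB : max_stable B by apply/bi; right.
have dAB : [disjoint A & B].
  by case: sAB => -> _ _; rewrite -setI_eq0 setICr.
split=> [|a b aA bB]; first exact: disjoint_max_stable mA mB dAB.
have [/andP[_ /eqP cA] /andP[_ /eqP cB]] := (mA, mB).
have bA : b \notin A by rewrite -(bisplit_memB sAB).
have aB : a \notin B by rewrite (bisplit_memB sAB) aA.
have cA' := card_trace_delete2 aA bA.
have cB' : #|trace (~: [set a; b]) B| = #|B|.-1.
  by rewrite setUC card_trace_delete2.
have aH : alpha (delete2 a b) = (alpha G).-1.
  apply: alphaP (stable_trace _ sA) _ _ => [|T sT]; first by rewrite cA' cA.
  rewrite -ltnS (@leq_trans (alpha G)) ?leqSpred // ltn_neqAle.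
  rewrite -card_extend -stable_extend in sT *; rewrite stable_card // andbT.
  apply/negP => cT; have /bi[] : max_stable (extend T) by rewrite /max_stable sT.
    by move=> e; have /subsetP/(_ a) := extend_sub T; rewrite e aA !inE eqxx => /(_ isT).
  by move=> e; have /subsetP/(_ b) := extend_sub T;
     rewrite e bB !inE eqxx orbT => /(_ isT).
apply: (@disjoint_max_stable _ (trace _ A) (trace _ B)).
- by rewrite /max_stable stable_trace // cA' aH cA /=.
- by rewrite /max_stable stable_trace // cB' aH cB /=.
- by case: (bisplit_trace (~: [set a; b]) sAB) => -> _ _; rewrite -setI_eq0 setICr.
Qed.

(** * From bistability to condition (v) *)

Lemma bistableC A B : bistable A B -> bistable B A.
Proof. by case=> neAB bi; split=> [/esym//|S]; rewrite bi; split; case; auto. Qed.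

Lemma bistable_expanding A B : bisplit A B -> bistable A B -> expanding A.
Proof.
move=> sAB [_ bi] X X0 XA; rewrite ltnNge; apply/negP => le.
have [_ /stableP sA /stableP sB] := sAB; have sXA := proper_sub XA.
have /andP[_ /eqP cB] : max_stable B by apply/bi; right.
have sNB := neighbours_subB sAB sXA.
pose S := X :|: (B :\: neighbours X).
have SA : S :&: A = X.
  apply/setP => x; rewrite !inE (bisplit_memB sAB).
  by case: (boolP (x \in A)) => xA; rewrite ?andbF ?orbF ?andbT //;
     apply/esym/negP => /(subsetP sXA); apply/negP.
have sS : stable S.
  have cross x y : x \in X -> y \notin neighbours X -> ~~ adj x y.
    by move=> xX; apply: contra => xy; apply: mem_neighbours xy.
  apply/stableP => x y /setUP[xX|/setDP[xB xN]] /setUP[yX|/setDP[yB yN]].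
  - by apply: sA; apply: (subsetP sXA).
  - exact: cross.
  - by rewrite adj_sym cross.
  - exact: sB.
have mS : max_stable S.
  rewrite /max_stable sS eqn_leq stable_card //= -cB cardsU.
  have -> : X :&: (B :\: neighbours X) = set0.
    apply/setP => x; rewrite !inE (bisplit_memB sAB).
    by case: (boolP (x \in X)) => // /(subsetP sXA) ->; rewrite andbF.
  by have := cardsID (neighbours X) B; rewrite (setIidPr sNB) cards0; lia.
(* [S :&: A = X] excludes both options: [S = A] would make [X] all of [A], and [S = B] would make it
   empty. *)
case/bi: mS => e; move: SA; rewrite e.
  by rewrite setIid => e'; rewrite e' properxx in XA.
move=> e'; case/eqP: X0; rewrite -e'; apply/setP => x.
by rewrite !inE (bisplit_memB sAB) andNb.
Qed.

(** Without one vertex, [A] is a proper subset with more than [#|A| - 1] neighbours in [B]; for a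
    singleton [A], [B != set0] suffices. *)
Lemma expanding_card_le A B : bisplit A B -> A != set0 -> B != set0 ->
  expanding A -> #|A| <= #|B|.
Proof.
move=> sAB /set0Pn[a aA] B0 exA; rewrite (cardsD1 a A) aA.
have [->|X0] := eqVneq (A :\ a) set0; first by rewrite cards0 card_gt0.
have := exA _ X0 (properD1 aA).
have := subset_leq_card (neighbours_subB sAB (subsetDl A [set a])); lia.
Qed.

Lemma expanding_neighbour A x : expanding A -> 1 < #|A| -> x \in A ->
  exists y, adj x y.
Proof.
move=> exA cA xA.
have : 0 < #|neighbours [set x]|.
  apply: leq_trans (exA [set x] _ _); first by rewrite cards1.
    by apply/set0Pn; exists x; rewrite set11.
  by rewrite properEcard sub1set xA cards1.
by case/card_gt0P => y /neighboursP[_ /set1P-> xy]; exists y.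
Qed.

(** * Consequences of condition (v) *)

Section Expanding.
Variables A B : {set G}.
Hypotheses (sAB : bisplit A B) (A0 : A != set0) (B0 : B != set0).
Hypotheses (exA : expanding A) (exB : expanding B).

(** The comparison runs both ways. The bound [1 < #|A|], due to the four vertices, makes singletons
    proper subsets. *)
Lemma expanding_card : #|A| = #|B| /\ 1 < #|A|.
Proof.
have := expanding_card_le sAB A0 B0 exA.
have := expanding_card_le (bisplitC sAB) B0 A0 exB.
by have := bisplit_cardT sAB; lia.
Qed.

(** If [S] contains [A], no vertex of [B] fits, each having a neighbour in [A]. If [S :&: A] is
    nonempty and proper, [S :&: B] avoids its more numerous neighbours. *)
Lemma expanding_stable S : stable S ->
  [\/ S = A, S = B | #|S| < #|A|].
Proof.
move=> /stableP sS; have [cAB cA] := expanding_card.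
have cS := bisplit_card sAB S.
have [SA0|SA0] := eqVneq (S :&: A) set0.
  have SB : S \subset B.
    apply/subsetP => x xS; rewrite (bisplit_memB sAB); apply/negP => xA.
    by have := introT setIP (conj xS xA); rewrite SA0 inE.
  have [->|ne] := eqVneq S B; first by constructor 2.
  by constructor 3; rewrite cAB; apply: proper_card; rewrite properEneq ne.
have [SA|nSA] := eqVneq (S :&: A) A.
  constructor 1; apply/eqP; rewrite eqEsubset -{2}SA subsetIl andbT.
  apply/subsetP => x xS; apply/negPn/negP; rewrite -(bisplit_memB sAB) => xB.
  have [|y xy] := expanding_neighbour exB _ xB; first by rewrite -cAB.
  have : y \in A by rewrite (bisplit_adj sAB xy).
  by rewrite -SA inE => /andP[yS _]; move/negP: (sS x y xS yS).
constructor 3.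
have pX : S :&: A \proper A by rewrite properEneq nSA subsetIr.
have := exA SA0 pX.
have sN := neighbours_subB sAB (proper_sub pX).
have : S :&: B \subset B :\: neighbours (S :&: A).
  apply/subsetP => y /setIP[yS yB]; rewrite inE yB andbT.
  by apply/negP => /neighboursP[x /setIP[xS _] xy]; move/negP: (sS x y xS yS).
move/subset_leq_card; have := cardsID (neighbours (S :&: A)) B.
by rewrite (setIidPr sN); lia.
Qed.

Lemma expanding_bistable : bistable A B.
Proof.
have [cAB cA] := expanding_card; have [_ sA sB] := sAB.
have aG : alpha G = #|A|.
  apply: alphaP sA _ _ => // T /expanding_stable[->|->|/ltnW] //.
  by rewrite cAB.
split=> [e|S].
  have /card_gt0P[x xA] : 0 < #|A| by lia.
  by have := bisplit_memB sAB x; rewrite -e xA.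
split=> [/andP[/expanding_stable[]]|[]->].
- by left.
- by right.
- by rewrite aG => lt /eqP e; rewrite e ltnn in lt.
- by rewrite /max_stable sA aG eqxx.
- by rewrite /max_stable sB aG cAB eqxx.
Qed.

Lemma expanding_connected : connected G.
Proof.
have [cAB cA] := expanding_card.
have symG : connect_sym (@adj G) by apply/sym_connect_sym/adj_sym.
(* [C], the vertices reachable from [x], is closed under neighbours; proper parts on both sides
   would give [#|C :&: D| < #|C :&: E| < #|C :&: D|]. *)
have link D E x : bisplit D E -> expanding D -> expanding E -> 1 < #|D| ->
  x \in D -> D \subset connect (@adj G) x.
  move=> sDE exD exE cD xD; pose C := [set y | connect (@adj G) x y].
  have NC X : X \subset C -> neighbours X \subset C.
    move=> XC; apply/subsetP => z /neighboursP[y /(subsetP XC)].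
    by rewrite !inE => xy yz; apply: connect_trans xy (connect1 yz).
  have [CD|nCD] := eqVneq (C :&: D) D.
    by apply/subsetP => y; rewrite -CD !inE => /andP[].
  have CD0 : C :&: D != set0 by apply/set0Pn; exists x; rewrite !inE connect0.
  have pCD : C :&: D \proper D by rewrite properEneq nCD subsetIr.
  have lt1 := exD _ CD0 pCD.
  have : neighbours (C :&: D) \subset C :&: E.
    by rewrite subsetI NC ?subsetIl // (neighbours_subB sDE) ?subsetIr.
  move/subset_leq_card => le1.
  have CE0 : C :&: E != set0 by rewrite -card_gt0; lia.
  have [CE|nCE] := eqVneq (C :&: E) E.
    (* When [C] contains [E], a vertex of [D] outside [C] still has a neighbour in [E], and so is
       reachable. *)
    have /properP[_ [y yD yC]] := pCD.
    have [z yz] := expanding_neighbour exD cD yD.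
    have : z \in E.
      by rewrite (bisplit_memB sDE) (bisplit_adj sDE yz) (bisplit_memB sDE) yD.
    rewrite -CE !inE => /andP[xz _]; case/negP: yC; rewrite !inE yD andbT.
    by apply: connect_trans xz (connect1 _); rewrite adj_sym.
  have pCE : C :&: E \proper E by rewrite properEneq nCE subsetIr.
  have lt2 := exE _ CE0 pCE.
  have : neighbours (C :&: E) \subset C :&: D.
    rewrite subsetI NC ?subsetIl //=.
    by rewrite (neighbours_subB (bisplitC sDE)) ?subsetIr.
  by move/subset_leq_card; lia.
have linkA x y : x \in A -> y \in A -> connect (@adj G) x y.
  by move=> xA; move: y; apply/subsetP/(link A B).
have toA x : exists2 y, y \in A & connect (@adj G) x y.
  have [xA|xA] := boolP (x \in A); first by exists x; rewrite ?connect0.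
  have xB : x \in B by rewrite (bisplit_memB sAB).
  have [|y xy] := expanding_neighbour exB _ xB; first by rewrite -cAB.
  by exists y; rewrite ?(bisplit_adj sAB xy) // connect1.
move=> x y; have [x' x'A xx'] := toA x; have [y' y'A yy'] := toA y.
apply: connect_trans xx' (connect_trans (linkA _ _ x'A y'A) _).
by rewrite symG.
Qed.

(** For Hall's condition: a nonempty set on the [A] side misses [a], so it is proper and its strict
    surplus of neighbours pays for the loss of [b]. *)
Lemma expanding_delete2 a b : a \in A -> b \in B ->
  has_perfect_matching (delete2 a b).
Proof.
move=> aA bB; have [cAB cA] := expanding_card.
have bA : b \notin A by rewrite -(bisplit_memB sAB).
have aB : a \notin B by rewrite (bisplit_memB sAB) aA.
apply: (hall_perfect_matching (bisplit_trace _ sAB)).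
  rewrite card_trace_delete2 // [in RHS]setUC card_trace_delete2 //.
  by rewrite cAB.
move=> X XA; rewrite -card_extend -[leqRHS]card_extend.
have [->|X0] := eqVneq (extend X) set0; first by rewrite cards0.
have XA' : extend X \proper A.
  apply/properP; split; last first.
    by exists a => //; apply/negP => /(subsetP (extend_sub X)); rewrite !inE eqxx.
  by apply/subsetP => _ /imsetP[u /(subsetP XA) + ->]; rewrite inE.
have lt := exA X0 XA'.
have sub : neighbours (extend X) :\ b \subset extend (neighbours X).
  apply/subsetP => y /setD1P[yb yN].
  have yB := subsetP (neighbours_subB sAB (proper_sub XA')) _ yN.
  have yK : y \in ~: [set a; b].
    by rewrite !inE negb_or yb andbT; apply: contraNneq aB => <-.
  have /neighboursP[_ /imsetP[u uX ->] uy] := yN.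
  rewrite -[y](SubK {x | x \in ~: [set a; b]} yK) mem_extend.
  by apply: (mem_neighbours uX); rewrite /= /induced_adj SubK.
have := subset_leq_card sub; have := cardsD1 b (neighbours (extend X)); lia.
Qed.

Lemma expanding_edge_matching (e : {set G}) : e \in edges G ->
  exists M : {set {set G}}, perfect_matching M /\ e \in M.
Proof.
case/imsetP=> [[x y]]; rewrite inE /= => xy ->.
wlog xA : x y xy / x \in A.
  move=> wl; have [|xA] := boolP (x \in A); first exact: wl.
  rewrite setUC; apply: wl; first by rewrite adj_sym.
  by rewrite (bisplit_adj sAB xy) (bisplit_memB sAB).
apply: perfect_matching_delete2 => //; apply: expanding_delete2 => //.
by rewrite (bisplit_memB sAB) (bisplit_adj sAB xy) (bisplit_memB sAB) xA.
Qed.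

End Expanding.

(** * From perfect matchings to condition (v) *)

Lemma delete2_expanding A B : bisplit A B -> B != set0 ->
  (forall a b, a \in A -> b \in B -> has_perfect_matching (delete2 a b)) ->
  expanding A.
Proof.
move=> sAB B0 pm X X0 /properP[XA [a aA aX]].
have le b : b \in B -> #|X| <= #|neighbours X :\ b|.
  move=> bB; have XK : X \subset ~: [set a; b].
    apply/subsetP => x xX; rewrite !inE negb_or; apply/andP; split.
      by apply: contraNneq aX => <-.
    by apply: contraTneq bB => <-; rewrite (bisplit_memB sAB) (subsetP XA).
  apply: leq_trans (card_neighbours_induced (pm a b aA bB) XK) _.
  apply/subset_leq_card/subsetP => x /setIP[xN].
  by rewrite !inE negb_or => /andP[_ ->]; move: xN; rewrite inE.
(* With no neighbours, any [b] gives [#|X| <= 0]; otherwise [b] chosen in [N(X)] makes the bound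
   strict. *)
have [N0|[b bN]] := set_0Vmem (neighbours X).
  have /set0Pn[b bB] := B0; have := le b bB.
  by rewrite N0 set0D cards0 leqn0 cards_eq0 (negbTE X0).
have := le b (subsetP (neighbours_subB sAB XA) _ bN).
by rewrite (cardsD1 b (neighbours X)) bN.
Qed.

Lemma edge_matching_expanding A B : bisplit A B -> connected G ->
  (forall e : {set G}, e \in edges G ->
     exists M : {set {set G}}, perfect_matching M /\ e \in M) ->
  expanding A.
Proof.
move=> sAB cG em X X0 /properP[XA [a aA aX]].
have [x xX] := set0Pn _ X0.
(* connectedness provides an edge uv leaving X :|: N(X); a perfect matching
   containing uv then injects X into N(X) minus one vertex *)
have [u [v [uX uA vN uv]]] : exists u v,
  [/\ u \notin X, u \in A, v \in neighbours X & adj u v].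
  have /connectP[p pth lst] := cG x a.
  have : x \in X :|: neighbours X by rewrite inE xX.
  elim: p x pth lst {xX} => [|y p IHp] x /=.
    move=> _ <- /setUP[aX'|aN]; first by rewrite aX' in aX.
    have := subsetP (neighbours_subB sAB XA) _ aN.
    by rewrite (bisplit_memB sAB) aA.
  case/andP=> xy pth lst xC.
  have [yC|yC] := boolP (y \in X :|: neighbours X); first exact: IHp pth lst yC.
  move: yC; rewrite inE negb_or => /andP[yX yN].
  (* A step from [X] lands in [N(X)], so the path can only leave from [N(X)], into [A]. *)
  case/setUP: xC => [xX|xN].
    by case/negP: yN; apply: mem_neighbours xX xy.
  exists y, x; split=> //; last by rewrite adj_sym.
  by rewrite (bisplit_adj sAB xy) (subsetP (neighbours_subB sAB XA)).
have [M [/perfect_matching_partner[g [adjg gK gM]] uvM]] := em _ (edge_mem uv).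
have gu : g u = v := gM _ _ uvM.
rewrite (cardsD1 v (neighbours X)) vN ltnS -(card_imset _ (inv_inj gK)).
apply/subset_leq_card/subsetP => _ /imsetP[y yX ->].
rewrite in_setD1 (mem_neighbours yX (adjg y)) andbT -gu (inj_eq (inv_inj gK)).
by apply: contraNneq uX => <-.
Qed.

End Bistable.

Theorem theorem3 (G : sgraph) (A B : {set G})
  (bipG : bipartition A B) (cardG : 4 <= #|G|) :
  [<-> bistable A B;
       alpha_plus_stable G /\
         (forall a b : G, a \in A -> b \in B ->
            alpha_plus_stable (delete2 a b));
       (forall a b : G, a \in A -> b \in B ->
          has_perfect_matching (delete2 a b));
       connected G /\
         (forall e : {set G}, e \in edges G ->
            exists M : {set {set G}}, perfect_matching M /\ e \in M);
       (forall X : {set G}, X != set0 -> X \proper A ->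
          #|X| < #|neighbours X|) /\
         (forall X : {set G}, X != set0 -> X \proper B ->
            #|X| < #|neighbours X|)].
Proof.
have sAB := bipartition_bisplit bipG; have sBA := bisplitC sAB.
have [A0 B0 _ _ _] := bipG.
have iii_v : (forall a b, a \in A -> b \in B -> has_perfect_matching (delete2 a b)) ->
    expanding A /\ expanding B.
  move=> pm; split; first exact: delete2_expanding sAB B0 pm.
  by apply: delete2_expanding sBA A0 _ => b a bB aA; rewrite delete2C; apply: pm.
(* The implications run in a cycle; (ii) reaches (iii) through (i) and (v), and (iii) reaches (iv)
   through (v). *)
tfae.
- exact: bistable_alpha_plus_stable.
- case=> aG h2 a b.
  have bi := alpha_plus_stable_bistable cardG sAB aG h2.
  apply: expanding_delete2 => //; first exact: bistable_expanding sAB bi.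
  exact: bistable_expanding sBA (bistableC bi).
- case/iii_v=> exA exB; split; first exact: expanding_connected exA exB.
  exact: expanding_edge_matching exA exB.
- case=> cG em; split; first exact: edge_matching_expanding sAB cG em.
  exact: edge_matching_expanding sBA cG em.
- by case=> exA exB; apply: expanding_bistable.
Qed.
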